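(* Let $\mu>0$ and $\theta>0$, let $A\in\mathbb{R}^{m\times n}$ or $\mathbb{C}^{m\times n}$ with $m\le n$, let $f\in\mathbb{R}^m$ or $\mathbb{C}^m$, and let $L\in\mathbb{R}^{n\times n}$. Consider ADMM for the linear quadratic problem $\min_u \frac{\mu}{2}\|Au-f\|^2+\frac12\|Lu\|^2$, i.e. from initial $u^0,b^0$ the iteration $$w^{k+1}=(L^TL+\theta I)^{-1}(\theta u^k+\theta b^k),$$ $$u^{k+1}=(\mu A^TA+\theta I)^{-1}(\theta w^{k+1}-\theta b^k+\mu A^Tf),$$ $$b^{k+1}=b^k+u^{k+1}-w^{k+1}.$$ (i) The ADMM iterations can be transformed into (are equivalent to) the following fixed-point iteration system, solely with respect to the variable $u$: $$u^{k+1}=(I+Q)u^k-(\mu A^TA+\theta I)^{-1}(\theta\mu A^Tf),$$ where $I+Q$ is the iteration matrix, with $$Q=\theta(\mu A^TA+\theta I)^{-1}\Big((L^TL+\theta I)^{-1}(\theta I-\mu A^TA)-I\Big).$$ (ii) Given a value of $\mu$, $$\rho(I+Q)\le 1$$ regardless of the value of $\theta$. (iii) Since the convergence factor $\zeta$ of the ADMM iteration is equal to the spectral radius of the iteration matrix, $\zeta$ is bounded by $1$, meaning that the ADMM iteration (equivalently, the fixed-point iteration in (i)) is unconditionally convergent.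
   Context: $\rho(T)$ denotes the spectral radius of a square matrix $T$, $I$ is the $n\times n$ identity matrix, and $\|\cdot\|$ is the $L_2$ norm. $A^T$ denotes the transpose (conjugate transpose if $A$ is complex). The ADMM updates are the minimizations, first over $w$ and then over $u$, of $\frac{\mu}{2}\|Au-f\|^2+\frac12\|Lw\|^2+\frac\theta2\|w-u-b\|^2$, followed by the update of the Lagrangian multiplier $b$; $\theta$ is the penalty parameter and $\mu$ the regularization parameter. For a fixed-point iteration $u^{k+1}=Tu^k+c$ with optimal solution $u^*$, the convergence factor is defined as $\zeta=\sup_{k:u^k\ne u^*}\|u^{k+1}-u^*\|/\|u^k-u^*\|$, and it is taken as known that $\zeta=\rho(T)$.
   Formalization: In (i) the constant is corrected to +(μAᵀA+θI)⁻¹(LᵀL+θI)⁻¹θμAᵀf (the printed one is false); the recursion is claimed for k≥1, and at k=0 only if θb⁰=μAᵀ(f−Au⁰). In (iii) ζ=ρ(T) is assumed for each sequence, for ADMM from index 1; convergence is proved without it. *)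

(* Defs.v *)
From mathcomp Require Import all_boot all_order all_algebra.
From mathcomp Require Import all_classical all_reals all_analysis.
From mathcomp Require Import complex.

Set Implicit Arguments.
Unset Strict Implicit.
Unset Printing Implicit Defensive.

Import Order.TTheory GRing.Theory Num.Theory.
Import numFieldNormedType.Exports.

Local Open Scope classical_set_scope.
Local Open Scope ring_scope.

Variant ground := Reals | Complexes.

Definition ground_field (R : realType) (F : ground) : numFieldType :=
  match F with Reals => R | Complexes => R[i] end.

Definition of_real (R : realType) (F : ground) : R -> ground_field R F :=
  match F with Reals => fun x => x | Complexes => fun x => (x%:C)%C end.

Definition to_complex (R : realType) (F : ground) : ground_field R F -> R[i] :=
  match F with Reals => fun x => (x%:C)%C | Complexes => fun z => z end.

Definition ground_conj (R : realType) (F : ground) : ground_field R F -> ground_field R F :=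
  match F with Reals => fun x => x | Complexes => fun z => (z^*)%C end.

Definition modulus (R : realType) (F : ground) : ground_field R F -> R :=
  match F with Reals => fun x => `|x| | Complexes => fun z => Normc.normc z end.

Section LinearAlgebra.
Context (R : realType) (F : ground).
Local Notation K := (ground_field R F).

Definition adjoint m n (A : 'M[K]_(m, n)) : 'M[K]_(n, m) :=
  (map_mx (@ground_conj R F) A)^T.

Definition l2norm n (v : 'cV[K]_n) : R :=
  Num.sqrt (\sum_i modulus (v i 0) ^+ 2).

(* Eigenvalues are complex also when T is a real matrix.  The spectrum is
   finite, so that the supremum is a maximum when 0 < n. *)
Definition spectral_radius n (T : 'M[K]_n) : R :=
  sup [set Normc.normc a | a in
        [set a : R[i] | eigenvalue (map_mx (@to_complex R F) T) a]].

Definition converges_to n (u : nat -> 'cV[K]_n) (v : 'cV[K]_n) : Prop :=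
  l2norm (u k - v) @[k --> \oo] --> (0 : R).

Definition fixed_point_iteration n (T : 'M[K]_n) (c : 'cV[K]_n)
    (u : nat -> 'cV[K]_n) : Prop :=
  forall k, u k.+1 = T *m u k + c.

(* Taken in \bar R: the set of ratios may be unbounded (factor +oo), or empty
   when u is constantly equal to ustar (factor -oo). *)
Definition convergence_factor n (u : nat -> 'cV[K]_n) (ustar : 'cV[K]_n)
    : \bar R :=
  ereal_sup [set (l2norm (u k.+1 - ustar) / l2norm (u k - ustar))%:E
            | k in [set k | u k <> ustar]].

End LinearAlgebra.

Section ADMM.
Context (R : realType) (F : ground) (m n : nat).
Local Notation K := (ground_field R F).
Local Notation "x %:K" := (of_real F x) (at level 2, format "x %:K").
Variables (mu theta : R) (A : 'M[K]_(m, n)) (f : 'cV[K]_m) (L : 'M[R]_n).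
Local Notation LK := (map_mx (@of_real R F) L).

Definition objective (u : 'cV[K]_n) : R :=
  mu / 2 * l2norm (A *m u - f) ^+ 2 + 1 / 2 * l2norm (LK *m u) ^+ 2.

Definition optimal_solution (u : 'cV[K]_n) : Prop :=
  forall v, objective u <= objective v.

Definition u_resolvent : 'M[K]_n :=
  invmx (mu%:K *: (adjoint A *m A) + theta%:K%:M).

Definition w_resolvent : 'M[K]_n := invmx (LK^T *m LK + theta%:K%:M).

(* The initial u 0 and b 0 are arbitrary; w 0 plays no role. *)
Definition admm (u w b : nat -> 'cV[K]_n) : Prop :=
  forall k,
    [/\ w k.+1 = w_resolvent *m (theta%:K *: u k + theta%:K *: b k),
        u k.+1 = u_resolvent *m (theta%:K *: w k.+1 - theta%:K *: b k
                                 + mu%:K *: (adjoint A *m f))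
      & b k.+1 = b k + u k.+1 - w k.+1].

Definition Q : 'M[K]_n :=
  theta%:K *: (u_resolvent *m
    (w_resolvent *m (theta%:K%:M - mu%:K *: (adjoint A *m A)) - 1%:M)).

Definition iteration_matrix : 'M[K]_n := 1%:M + Q.

(* Since mu *: A^* A *m u k.+1 + theta *: b k.+1 = mu *: A^* f, the multiplier
   is eliminated as b k = (mu / theta) *: A^* (f - A *m u k), and the terms in f
   that remain in the update of u are the following ones. *)
Definition iteration_offset : 'cV[K]_n :=
  u_resolvent *m (w_resolvent *m ((theta * mu)%:K *: (adjoint A *m f))).

(* This relation between u k and b k holds for all k >= 1 whatever the initial
   values are; at k = 0 it is a condition on u 0 and b 0. *)
Definition multiplier_consistent (u b : 'cV[K]_n) : Prop :=
  theta%:K *: b = mu%:K *: (adjoint A *m (f - A *m u)).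

End ADMM.

(* Main.v *)
(* Put M = mu A^*A, N = L^T L and g = mu A^*f.  From the first step on,
   theta b = g - M u, so that the w-step reads (N + theta) w = theta u + g - M u
   and the next iterate u' satisfies (M + theta) u' = M u + theta w.  In the
   variable t = (M + theta) u this is a Douglas-Rachford step: monotonicity of M
   and N makes the linear part T firmly nonexpansive,
   |Tx|_H^2 + |x - Tx|_H^2 <= |x|_H^2 for the norm |x|_H = |(M + theta) x|, so
   that every eigenvalue of T has modulus at most 1.  Moreover the increments of
   each orbit of T tend to 0, whence ker (1 - T)^2 = ker (1 - T); thus each
   vector is the sum of a fixed point of T and of an element of the range of
   1 - T, which T^k sends to 0 as k grows.  The fixed points of u |-> T u + c are
   the solutions of (M + N) u = g, which exist since ker (M + N) is contained in
   ker A. *)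

Require Import Defs.
From mathcomp Require Import all_boot all_order all_algebra.
From mathcomp Require Import all_classical all_reals all_analysis.
From mathcomp Require Import complex.
From HB Require Import structures.
From mathcomp Require Import ring lra.

Import Order.TTheory GRing.Theory Num.Theory.
Import numFieldNormedType.Exports.

Local Open Scope ring_scope.

Set Implicit Arguments.
Unset Strict Implicit.
Unset Printing Implicit Defensive.

(** * Uniform treatment of the real and complex ground fields *)

Section GroundField.
Context (R : realType) (F : ground).
Local Notation K := (ground_field R F).

Lemma ground_conj_is_zmod_morphism : zmod_morphism (@ground_conj R F).
Proof. by case: F => //= x y; rewrite rmorphB. Qed.

Lemma ground_conj_is_monoid_morphism : monoid_morphism (@ground_conj R F).
Proof. by case: F => //=; split=> [|x y]; rewrite ?rmorph1 ?rmorphM. Qed.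

HB.instance Definition _ := GRing.isZmodMorphism.Build K K (@ground_conj R F)
  ground_conj_is_zmod_morphism.
HB.instance Definition _ := GRing.isMonoidMorphism.Build K K (@ground_conj R F)
  ground_conj_is_monoid_morphism.

Lemma of_real_is_zmod_morphism : zmod_morphism (@of_real R F).
Proof. by case: F => //= x y; rewrite rmorphB. Qed.

Lemma of_real_is_monoid_morphism : monoid_morphism (@of_real R F).
Proof. by case: F => //=; split=> [|x y]; rewrite ?rmorph1 ?rmorphM. Qed.

HB.instance Definition _ := GRing.isZmodMorphism.Build R K (@of_real R F)
  of_real_is_zmod_morphism.
HB.instance Definition _ := GRing.isMonoidMorphism.Build R K (@of_real R F)
  of_real_is_monoid_morphism.

Lemma to_complex_is_zmod_morphism : zmod_morphism (@to_complex R F).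
Proof. by case: F => //= x y; rewrite rmorphB. Qed.

Lemma to_complex_is_monoid_morphism : monoid_morphism (@to_complex R F).
Proof. by case: F => //=; split=> [|x y]; rewrite ?rmorph1 ?rmorphM. Qed.

HB.instance Definition _ := GRing.isZmodMorphism.Build K R[i] (@to_complex R F)
  to_complex_is_zmod_morphism.
HB.instance Definition _ := GRing.isMonoidMorphism.Build K R[i] (@to_complex R F)
  to_complex_is_monoid_morphism.

Definition ground_re : K -> R :=
  match F with Reals => id | Complexes => @complex.Re R end.

Lemma ground_re_is_zmod_morphism : zmod_morphism ground_re.
Proof. by rewrite /ground_re; case: F => //= -[? ?] [? ?]. Qed.

HB.instance Definition _ := GRing.isZmodMorphism.Build K R ground_re
  ground_re_is_zmod_morphism.

Lemma ground_reZ (a : R) (x : K) : ground_re (of_real F a * x) = a * ground_re x.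
Proof. by rewrite /ground_re; case: F x => //= -[x y]; rewrite /= mul0r subr0. Qed.

Lemma ground_re_conj (x : K) : ground_re (ground_conj x) = ground_re x.
Proof. by rewrite /ground_re; case: F x => //= -[]. Qed.

Lemma ground_conjK : involutive (@ground_conj R F).
Proof. by case: F => //= x; rewrite conjcK. Qed.

Lemma ground_conj_real (a : R) : ground_conj (of_real F a) = of_real F a.
Proof. by case: F => //=; rewrite oppr0. Qed.

Lemma ground_re_norm (x : K) : ground_re (ground_conj x * x) = modulus x ^+ 2.
Proof.
rewrite /ground_re; case: F x => //= [x|[x y]] /=.
  by rewrite real_normK ?num_real.
by rewrite sqr_sqrtr ?addr_ge0 ?sqr_ge0 //; ring.
Qed.

Lemma modulusM (x y : K) : modulus (x * y) = modulus x * modulus y.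
Proof. by case: F x y => /= x y; rewrite ?normrM ?Normc.normcM. Qed.

Lemma modulus0_eq0 (x : K) : modulus x = 0 -> x = 0.
Proof. by case: F x => //= x; [move/normr0_eq0 | move/Normc.eq0_normc]. Qed.

Lemma modulus_ge0 (x : K) : 0 <= modulus x.
Proof. by case: F x => /= [x|[x y]]; rewrite ?normr_ge0 ?sqrtr_ge0. Qed.

Lemma to_complex_conj (x : K) :
  to_complex (ground_conj x) = @ground_conj R Complexes (to_complex x).
Proof. by case: F x => //= x; rewrite oppr0. Qed.

Lemma to_complex_real (a : R) : to_complex (of_real F a) = of_real Complexes a.
Proof. by case: F. Qed.

End GroundField.

(** * The real inner product underlying the Euclidean norm *)

Section InnerProduct.
Context (R : realType) (F : ground).
Local Notation K := (ground_field R F).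
Local Notation "x %:K" := (of_real F x) (at level 2, format "x %:K").

Lemma adjointM m n p (A : 'M[K]_(m, n)) (B : 'M[K]_(n, p)) :
  adjoint (A *m B) = adjoint B *m adjoint A.
Proof. by rewrite /adjoint map_mxM trmx_mul. Qed.

Lemma adjointK m n (A : 'M[K]_(m, n)) : adjoint (adjoint A) = A.
Proof. by apply/matrixP => i j; rewrite !mxE ground_conjK. Qed.

Lemma adjointD m n (A B : 'M[K]_(m, n)) : adjoint (A + B) = adjoint A + adjoint B.
Proof. by rewrite /adjoint map_mxD linearD. Qed.

Lemma adjointZ m n (a : R) (A : 'M[K]_(m, n)) :
  adjoint (a%:K *: A) = a%:K *: adjoint A.
Proof. by rewrite /adjoint map_mxZ /= ground_conj_real linearZ. Qed.

(** Taking the real part of the Hermitian product makes the form symmetric and real-bilinear over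
    both fields, so that inequalities between expanded squares can be left to [lra] and [nra]. *)
Definition dot n (u v : 'cV[K]_n) : R := ground_re ((adjoint u *m v) 0 0).

Lemma dotDr n (u v w : 'cV[K]_n) : dot u (v + w) = dot u v + dot u w.
Proof. by rewrite /dot mulmxDr mxE raddfD. Qed.

Lemma dotZr n (a : R) (u v : 'cV[K]_n) : dot u (a%:K *: v) = a * dot u v.
Proof. by rewrite /dot -scalemxAr mxE ground_reZ. Qed.

Lemma dotNr n (u v : 'cV[K]_n) : dot u (- v) = - dot u v.
Proof. by rewrite /dot mulmxN mxE raddfN. Qed.

Lemma dotC n (u v : 'cV[K]_n) : dot u v = dot v u.
Proof.
by rewrite /dot -[u in RHS]adjointK -adjointM [in RHS]/adjoint !mxE ground_re_conj.
Qed.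

Lemma dotDl n (u v w : 'cV[K]_n) : dot (u + v) w = dot u w + dot v w.
Proof. by rewrite dotC dotDr !(dotC _ w). Qed.

Lemma dotZl n (a : R) (u v : 'cV[K]_n) : dot (a%:K *: u) v = a * dot u v.
Proof. by rewrite dotC dotZr dotC. Qed.

Lemma dotNl n (u v : 'cV[K]_n) : dot (- u) v = - dot u v.
Proof. by rewrite dotC dotNr dotC. Qed.

Definition dotE := (dotDl, dotDr, dotNl, dotNr, dotZl, dotZr).

Lemma dot_adjoint m n (A : 'M[K]_(m, n)) u v :
  dot u (adjoint A *m v) = dot (A *m u) v.
Proof. by rewrite /dot adjointM mulmxA. Qed.

Lemma dot_sum n (u : 'cV[K]_n) : dot u u = \sum_i modulus (u i 0) ^+ 2.
Proof.
rewrite /dot mxE raddf_sum; apply: eq_bigr => i _.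
by rewrite -ground_re_norm /adjoint !mxE.
Qed.

Lemma dot_ge0 n (u : 'cV[K]_n) : 0 <= dot u u.
Proof. by rewrite dot_sum sumr_ge0 // => i _; rewrite sqr_ge0. Qed.

Lemma dot_eq0 n (u : 'cV[K]_n) : dot u u = 0 -> u = 0.
Proof.
rewrite dot_sum => /eqP; rewrite psumr_eq0 => [/allP u0|i _]; last exact: sqr_ge0.
apply/matrixP => i j; rewrite (ord1 j) mxE; apply: modulus0_eq0.
by apply/eqP; rewrite -sqrf_eq0; have /= := u0 i (mem_index_enum _).
Qed.

Lemma dot_scale n (a : K) (u : 'cV[K]_n) :
  dot (a *: u) (a *: u) = modulus a ^+ 2 * dot u u.
Proof.
rewrite !dot_sum mulr_sumr; apply: eq_bigr => i _.
by rewrite mxE modulusM exprMn.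
Qed.

Lemma l2norm_dot n (u : 'cV[K]_n) : l2norm u = Num.sqrt (dot u u).
Proof. by rewrite /l2norm dot_sum. Qed.

Lemma l2norm_sqr n (u : 'cV[K]_n) : l2norm u ^+ 2 = dot u u.
Proof. by rewrite l2norm_dot sqr_sqrtr ?dot_ge0. Qed.

End InnerProduct.

(** * Kernels and ranges of matrices acting on column vectors *)

Lemma col_eq (T : Type) m n (A B : 'M[T]_(m, n)) :
  (forall j, col j A = col j B) -> A = B.
Proof.
move=> eqAB; apply/matrixP => i j.
by have /colP/(_ i) := eqAB j; rewrite !mxE.
Qed.

(** The columns of [cokermx A] are vectors killed by [A], so injectivity makes the cokernel
    vanish. *)
Lemma unitmx_inj (K : fieldType) n (A : 'M[K]_n) :
  (forall x : 'cV_n, A *m x = 0 -> x = 0) -> A \in unitmx.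
Proof.
move=> injA; rewrite -row_full_unit -cokermx_eq0; apply/eqP/col_eq => j.
by rewrite col0 colE; apply: injA; rewrite mulmxA mulmx_coker mul0mx.
Qed.

(** The columns of [cokermx B] lie in the kernel of [B], and [A] lies in the row space of [B] as
    soon as it kills them. *)
Lemma submx_ker (K : fieldType) m p n (A : 'M[K]_(m, n)) (B : 'M[K]_(p, n)) :
  (forall x : 'cV_n, B *m x = 0 -> A *m x = 0) -> (A <= B)%MS.
Proof.
move=> kerBA; rewrite submxE; apply/eqP/col_eq => j.
rewrite col0 colE -mulmxA; apply: kerBA.
by rewrite mulmxA mulmx_coker mul0mx.
Qed.

(** Equal kernels give S and S^2 the same rank, hence the same range. The transposes are there
    because [submx] compares row spaces. *)
Lemma image_sqr (K : fieldType) n (S : 'M[K]_n) :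
  (forall x : 'cV_n, S *m (S *m x) = 0 -> S *m x = 0) ->
  forall x : 'cV_n, exists z : 'cV_n, S *m x = S *m (S *m z).
Proof.
move=> kerS x.
have rkS : \rank (S *m S)^T = \rank S^T.
  rewrite !mxrank_tr; apply/eqP; rewrite eqn_leq mxrankM_maxl mxrankS //.
  by apply: submx_ker => y; rewrite -mulmxA; apply: kerS.
have : (S^T <= (S *m S)^T)%MS.
  have /mxrank_leqif_sup/geq_leqif <- : ((S *m S)^T <= S^T)%MS.
    by rewrite trmx_mul submxMl.
  by rewrite rkS.
case/submxP => D /(congr1 trmx); rewrite trmx_mul !trmxK => defS.
by exists (D^T *m x); rewrite !mulmxA -defS.
Qed.

(** * The Douglas-Rachford operator of two monotone matrices *)

Section Splitting.
Context (R : realType) (F : ground) (n : nat) (theta : R).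
Local Notation K := (ground_field R F).
Local Notation "x %:K" := (of_real F x) (at level 2, format "x %:K").

Definition monotone (M : 'M[K]_n) := forall x, 0 <= dot x (M *m x).

Hypothesis theta_gt0 : 0 < theta.

Definition shift (M : 'M[K]_n) : 'M[K]_n := M + theta%:K%:M.

Lemma shiftE M (x : 'cV_n) : shift M *m x = M *m x + theta%:K *: x.
Proof. by rewrite mulmxDl mul_scalar_mx. Qed.

(** The cross term 2 theta <x, M x> of the expanded square is nonnegative. The bound controls both
    |x| and |M x| by |(M + theta) x|. *)
Lemma shift_ge M (x : 'cV_n) : monotone M ->
  dot (M *m x) (M *m x) + theta ^+ 2 * dot x x
    <= dot (shift M *m x) (shift M *m x).
Proof.
move=> /(_ x) M_ge0; rewrite shiftE !dotE (dotC (M *m x) x).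
by have := mulr_ge0 (ltW theta_gt0) M_ge0; lra.
Qed.

Lemma shift_unit M : monotone M -> shift M \in unitmx.
Proof.
move=> monM; apply: unitmx_inj => x Hx0; apply: dot_eq0.
have := shift_ge x monM; rewrite Hx0.
have := dot_ge0 (M *m x); have := dot_ge0 x.
rewrite [dot 0 0]dot_sum big1 => [|i _]; last first.
  by rewrite mxE -ground_re_norm mulr0 raddf0.
by have := exprn_gt0 2 theta_gt0; nra.
Qed.

Variables (M N : 'M[K]_n).
Hypotheses (monM : monotone M) (monN : monotone N).

(** The iteration matrix with mu A^*A and L^T L replaced by arbitrary matrices, so that the
    contraction argument rests on monotonicity alone. *)
Definition splitting : 'M[K]_n :=
  1%:M + theta%:K *: (invmx (shift M) *m
    (invmx (shift N) *m (theta%:K%:M - M) - 1%:M)).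

Local Notation T := splitting.

(** One step as two linear equations without inverses; w is the intermediate point produced by the
    resolvent of N. *)
Lemma splittingE (x : 'cV_n) : exists2 w : 'cV_n,
  shift N *m w = theta%:K *: x - M *m x &
  shift M *m (T *m x) = M *m x + theta%:K *: w.
Proof.
exists (invmx (shift N) *m (theta%:K *: x - M *m x)).
  by rewrite mulKVmx ?shift_unit.
rewrite /splitting mulmxDl mul1mx mulmxDr -scalemxAl -scalemxAr -mulmxA.
rewrite mulKVmx ?shift_unit // mulmxBl mul1mx -mulmxA mulmxBl mul_scalar_mx.
by rewrite shiftE scalerBr -addrA subrKC.
Qed.

(** The squared norm |x|_H^2 in which T is firmly nonexpansive. *)
Definition energy (x : 'cV[K]_n) := dot (shift M *m x) (shift M *m x).

Lemma energy_ge0 x : 0 <= energy x. Proof. exact: dot_ge0. Qed.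

Lemma energy_ge x : theta ^+ 2 * dot x x <= energy x.
Proof.
have := shift_ge x monM; have := dot_ge0 (M *m x).
by rewrite /energy; lra.
Qed.

Lemma energy_eq0 x : energy x = 0 -> x = 0.
Proof.
move=> e0; apply: dot_eq0; have := energy_ge x; rewrite e0.
by have := dot_ge0 x; have := exprn_gt0 2 theta_gt0; nra.
Qed.

(** The gap between the two sides is exactly 2 theta (<x, M x> + <w, N w>), with w the intermediate
    point. *)
Lemma energy_splitting x : energy (T *m x) + energy (x - T *m x) <= energy x.
Proof.
have [w Nw MT] := splittingE x.
rewrite /energy mulmxBr MT shiftE.
have {}Nw : M *m x = theta%:K *: x - theta%:K *: w - N *m w.
  by rewrite -addrA -opprD addrC [_ + N *m w]addrC -shiftE Nw opprB addrNK.
have := monM x; have := monN w; rewrite Nw.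
move: (N *m w) => Nw'; rewrite !dotE => Nge Mge.
have := mulr_ge0 (ltW theta_gt0) Nge; have := mulr_ge0 (ltW theta_gt0) Mge.
rewrite (dotC w x) (dotC Nw' x) (dotC Nw' w); nra.
Qed.

(** Along an orbit the energy decreases and is bounded below, hence converges; the energy of an
    increment is at most the difference of two consecutive values. *)
Lemma splitting_regular (e : nat -> 'cV[K]_n) :
  (forall k, e k.+1 = T *m e k) ->
  (energy (e k - e k.+1) @[k --> \oo] --> (0 : R))%classic.
Proof.
move=> eT.
have e_dec k : energy (e k.+1) + energy (e k - e k.+1) <= energy (e k).
  by rewrite eT energy_splitting.
have e_cvg : cvgn (fun k => energy (e k)).
  apply: nonincreasing_is_cvgn.
    apply/nonincreasing_seqP => k.
    by have := e_dec k; have := energy_ge0 (e k - e k.+1); lra.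
  by exists 0 => _ [k _ <-]; exact: energy_ge0.
apply: (@squeeze_cvgr _ _ _ R (fun=> 0) (fun k => energy (e k) - energy (e k.+1))).
- near=> k; rewrite energy_ge0 /=; have := e_dec k; lra.
- exact: cvg_cst.
- rewrite -(subrr (limn (fun k => energy (e k)))).
  by apply: cvgB => //; rewrite (cvg_shiftS (fun k => energy (e k))).
Unshelve. all: by end_near. Qed.

(* With [y = (1 - T) x], [x - k y] is an orbit of T with constant
   increments, which must vanish by [splitting_regular]. *)
Lemma splitting_ker_sqr (x : 'cV[K]_n) :
  (1%:M - T) *m ((1%:M - T) *m x) = 0 -> (1%:M - T) *m x = 0.
Proof.
set y := _ *m x; move=> Sy.
have Ty : T *m y = y by apply/esym/subr0_eq; rewrite -Sy mulmxBl mul1mx.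
have Tx : T *m x = x - y by rewrite /y mulmxBl mul1mx opprB addrC subrK.
have /splitting_regular : forall k, x - y *+ k.+1 = T *m (x - y *+ k).
  by move=> k; rewrite mulmxBr Tx (raddfMn (mulmx T)) /= Ty mulrS opprD addrA.
under eq_fun do rewrite opprB addrC addrA subrK mulrS addrK.
move=> cy; apply: energy_eq0.
by rewrite -(cvg_lim (@Rhausdorff _) cy) (lim_cst (@Rhausdorff _)).
Qed.

Lemma splitting_cvg (e : nat -> 'cV[K]_n) :
  (forall k, e k.+1 = T *m e k) ->
  exists2 p, T *m p = p & (energy (e k - p) @[k --> \oo] --> (0 : R))%classic.
Proof.
(* With S = 1 - T, choosing z such that S (e 0) = S (S z) splits e 0 into S z and the fixed point p
   = e 0 - S z. *)
move=> eT; have [z Sz] := image_sqr splitting_ker_sqr (e 0%N).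
pose zs k := iter k (mulmx T) z.
set p := e 0%N - (1%:M - T) *m z.
have Tp : T *m p = p.
  apply/esym/subr0_eq; rewrite -[X in X - _]mul1mx -mulmxBl mulmxBr Sz.
  by rewrite subrr.
exists p => //.
(* The error e k - p = T^k (1 - T) z is an increment of the orbit of z. *)
rewrite (_ : (fun k => energy (e k - p)) = fun k => energy (zs k - zs k.+1)).
  exact: splitting_regular.
apply/funext => k; congr energy; elim: k => [|k IH].
  by rewrite /p opprB addrC subrK mulmxBl mul1mx.
by rewrite eT -Tp -mulmxBr IH mulmxBr.
Qed.

End Splitting.

(** * Convergence in norm from convergence of squared norms *)

Section NormConvergence.
Context (R : realType) (F : ground) (n : nat).
Local Notation K := (ground_field R F).
Local Open Scope classical_set_scope.

Lemma cvg_dot_le (C : R) (x : nat -> 'cV[K]_n) (a : nat -> R) :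
  0 < C -> (forall k, C * dot (x k) (x k) <= a k) ->
  a k @[k --> \oo] --> (0 : R) -> dot (x k) (x k) @[k --> \oo] --> (0 : R).
Proof.
move=> C0 xa a0.
apply: (@squeeze_cvgr _ _ _ R (fun=> 0) (fun k => C^-1 * a k)).
- by near=> k; rewrite dot_ge0 /= -ler_pdivrMl ?invr_gt0 // invrK.
- exact: cvg_cst.
- by rewrite -(mulr0 C^-1); apply: cvgMr.
Unshelve. all: by end_near. Qed.

Lemma converges_to_dot (u : nat -> 'cV[K]_n) (v : 'cV[K]_n) :
  dot (u k - v) (u k - v) @[k --> \oo] --> (0 : R) -> converges_to u v.
Proof.
move=> u0; rewrite /converges_to; under eq_fun do rewrite l2norm_dot.
suff : Num.sqrt (dot (u k - v) (u k - v)) @[k --> \oo] --> Num.sqrt (0 : R).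
  by rewrite sqrtr0.
apply: continuous_cvg => //.
exact: sqrt_continuous.
Qed.

Lemma converges_to_shift (u : nat -> 'cV[K]_n) (v : 'cV[K]_n) :
  converges_to (fun k => u k.+1) v -> converges_to u v.
Proof. by rewrite /converges_to -(cvg_shiftS (fun k => l2norm (u k - v))). Qed.

End NormConvergence.

(** * ADMM, its fixed-point form and its convergence *)

Section ADMM.
Context (R : realType) (F : ground) (m n : nat).
Local Notation K := (ground_field R F).
Local Notation "x %:K" := (of_real F x) (at level 2, format "x %:K").
Variables (mu theta : R) (A : 'M[K]_(m, n)) (f : 'cV[K]_m) (L : 'M[R]_n).
Hypotheses (mu_gt0 : 0 < mu) (theta_gt0 : 0 < theta).
Local Notation LK := (map_mx (@of_real R F) L).
Local Notation T := (iteration_matrix mu theta A L).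
Local Notation c := (iteration_offset mu theta A f L).
Local Notation M := (mu%:K *: (adjoint A *m A)).
Local Notation N := (LK^T *m LK).
Local Notation g := (mu%:K *: (adjoint A *m f)).
Local Notation W := (w_resolvent F theta L).

Lemma adjoint_real : adjoint LK = LK^T.
Proof. by apply/matrixP => i j; rewrite !mxE ground_conj_real. Qed.

Lemma dot_gram (x y : 'cV[K]_n) : dot x (M *m y) = mu * dot (A *m x) (A *m y).
Proof. by rewrite -scalemxAl dotZr -mulmxA dot_adjoint. Qed.

Lemma dot_gram_real (x y : 'cV[K]_n) : dot x (N *m y) = dot (LK *m x) (LK *m y).
Proof. by rewrite -adjoint_real -mulmxA dot_adjoint. Qed.

Lemma monotone_gram : monotone M.
Proof. by move=> x; rewrite dot_gram mulr_ge0 ?dot_ge0 // ltW. Qed.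

Lemma monotone_gram_real : monotone N.
Proof. by move=> x; rewrite dot_gram_real dot_ge0. Qed.

Lemma iteration_splitting : T = splitting theta M N.
Proof. by []. Qed.

Let shiftM_unit := shift_unit theta_gt0 monotone_gram.
Let shiftN_unit := shift_unit theta_gt0 monotone_gram_real.

(** The affine step cleared of the inverse of M + theta. The argument of [W] is theta (u + b) once
    theta b = g - M u is substituted. *)
Lemma shift_iteration (u : 'cV_n) :
  shift theta M *m (T *m u + c)
    = M *m u + theta%:K *: (W *m (theta%:K *: u + (g - M *m u))).
Proof.
have [w Nw Mu] := splittingE theta_gt0 monotone_gram monotone_gram_real u.
rewrite mulmxDr Mu /c mulKVmx // -addrA; congr (_ + _).
rewrite rmorphM /= -scalemxAr -scalerA -scalerDr addrCA mulmxDr -Nw.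
by rewrite -scalemxAr [W *m (_ *m w)]mulKmx // addrC.
Qed.

(** The normal equations: the gradient of the objective vanishes. *)
Definition normal_solution (u : 'cV[K]_n) := M *m u + N *m u = g.

(** A point is fixed exactly when the intermediate w equals u, and (N + theta) u = theta u + g - M u
    is the normal equation. *)
Lemma fixed_point_normal u : T *m u + c = u <-> normal_solution u.
Proof.
have th0 : theta%:K != 0 by rewrite fmorph_eq0 gt_eqF.
pose w := W *m (theta%:K *: u + (g - M *m u)).
have fixed_w : T *m u + c = u <-> w = u.
  split=> [fp|wu].
    apply: (scalerI th0); apply: (addrI (M *m u)).
    by rewrite -shift_iteration fp shiftE.
  by apply: (can_inj (mulKmx shiftM_unit)); rewrite shift_iteration -/w wu shiftE.
have w_normal : w = u <-> g - M *m u = N *m u.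
  split=> [wu|gu]; last by rewrite /w gu addrC -shiftE mulKmx.
  apply: (addrI (theta%:K *: u)).
  by rewrite [RHS]addrC -shiftE -[in RHS]wu mulKVmx.
rewrite /normal_solution; split=> [/fixed_w/w_normal <-|normal_u].
  by rewrite subrKC.
by apply/fixed_w/w_normal; rewrite -normal_u addrC addKr.
Qed.

(** If (M + N) x = 0, then mu |A x|^2 + |L x|^2 = 0 and so A x = 0. Hence A = D (M + N) for some D;
    taking adjoints, A^* = (M + N) D^*, which puts g in the range of M + N. *)
Lemma normal_solvable : exists u, normal_solution u.
Proof.
have : (A <= (M + N)%R)%MS.
  apply: submx_ker => x MNx0; apply: dot_eq0.
  have : dot x ((M + N) *m x) = 0.
    by rewrite MNx0 -[0](scale0r x) -(rmorph0 (@of_real R F)) dotZr mul0r.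
  rewrite mulmxDl dotDr dot_gram dot_gram_real => /eqP.
  rewrite paddr_eq0 ?mulr_ge0 ?dot_ge0 ?(ltW mu_gt0) // mulf_eq0 gt_eqF //=.
  by case/andP => /eqP.
case/submxP => D /(congr1 (@adjoint R F _ _)); rewrite adjointM => defA.
have MN_sym : adjoint (M + N) = M + N.
  by rewrite -adjoint_real adjointD adjointZ !adjointM !adjointK.
exists (mu%:K *: (adjoint D *m f)).
by rewrite /normal_solution -mulmxDl -scalemxAr mulmxA -[M + N]MN_sym -defA.
Qed.

(** At u + h the first-order terms cancel by the normal equations, leaving an excess of mu/2 |A h|^2
    + 1/2 |L h|^2. *)
Lemma normal_optimal u : normal_solution u -> optimal_solution mu A f L u.
Proof.
move=> normal_u v; rewrite /objective !l2norm_sqr.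
rewrite -(subrKC u v); move: (v - u) => h.
have : dot h (M *m u) + dot h (N *m u) = dot h g by rewrite -dotDr normal_u.
rewrite dot_gram dot_gram_real dotZr dot_adjoint !mulmxDr !dotE.
rewrite !(dotC _ (A *m h)) !(dotC _ (LK *m h)).
have := mulr_ge0 (ltW mu_gt0) (dot_ge0 (A *m h)); have := dot_ge0 (LK *m h).
rewrite (dotC f (A *m u)). lra.
Qed.

(** Errors with respect to one solution u0 form an orbit of T, which tends to a fixed point p of T;
    the limit u0 + p is again a solution. *)
Lemma fixed_point_energy_cvg (u : nat -> 'cV[K]_n) : fixed_point_iteration T c u ->
  exists2 us, normal_solution us &
    (energy theta M (u k - us) @[k --> \oo] --> (0 : R))%classic.
Proof.
move=> fpu; have [u0 normal_u0] := normal_solvable.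
have fp0 := (fixed_point_normal u0).2 normal_u0.
have step k : u k.+1 - u0 = T *m (u k - u0).
  by rewrite fpu -[X in _ - X]fp0 opprD addrACA subrr addr0 mulmxBr.
have [p Tp cvg_p] := splitting_cvg theta_gt0 monotone_gram monotone_gram_real step.
exists (u0 + p).
  apply/fixed_point_normal; rewrite -iteration_splitting in Tp.
  by rewrite mulmxDr Tp addrAC fp0.
by under eq_fun do rewrite opprD addrA.
Qed.

Lemma converges_to_energy (u : nat -> 'cV[K]_n) us :
  (energy theta M (u k - us) @[k --> \oo] --> (0 : R))%classic ->
  (dot (u k - us) (u k - us) @[k --> \oo] --> (0 : R))%classic.
Proof.
move=> cvg_u; apply: (@cvg_dot_le _ _ _ (theta ^+ 2) _ _ _ _ cvg_u).
  exact: exprn_gt0.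
by move=> k; apply: energy_ge monotone_gram _.
Qed.

Lemma multiplier_consistentE u b : multiplier_consistent mu theta A f u b <->
  theta%:K *: b = g - M *m u.
Proof. by rewrite -scalemxAl -scalerBr -mulmxA -mulmxBr. Qed.

(** Substituting theta b = g - M u turns the right-hand side theta w' - theta b + g of the u-update
    into M u + theta w'. *)
Lemma admm_step (u b u' w' : 'cV[K]_n) :
  multiplier_consistent mu theta A f u b ->
  w' = W *m (theta%:K *: u + theta%:K *: b) ->
  u' = u_resolvent mu theta A *m (theta%:K *: w' - theta%:K *: b + g) ->
  u' = T *m u + c.
Proof.
move=> /multiplier_consistentE bE -> ->; apply: (can_inj (mulKmx shiftM_unit)).
rewrite mulKVmx // shift_iteration bE [RHS]addrC -addrA; congr (_ + _).
by rewrite opprB subrK.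
Qed.

(** The u-update reads M u' + theta u' = theta w' - theta b + g, and theta times the b-update then
    gives theta b' = g - M u', whatever the previous values. *)
Lemma admm_multiplier (u w b : nat -> 'cV[K]_n) k : admm mu theta A f L u w b ->
  multiplier_consistent mu theta A f (u k.+1) (b k.+1).
Proof.
case/(_ k) => _ uE bE; apply/multiplier_consistentE.
have : shift theta M *m u k.+1 = theta%:K *: w k.+1 - theta%:K *: b k + g.
  by rewrite uE mulKVmx.
rewrite shiftE => Hu.
have -> : g = M *m u k.+1 + theta%:K *: u k.+1
    - (theta%:K *: w k.+1 - theta%:K *: b k).
  by rewrite Hu addrC addKr.
rewrite bE; move: (M *m _) (b k) => Mu bk.
by apply/matrixP => i j; rewrite !mxE; ring.
Qed.

Lemma admm_fixed_point (u w b : nat -> 'cV[K]_n) : admm mu theta A f L u w b ->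
  fixed_point_iteration T c (fun k => u k.+1).
Proof.
move=> admm_u k; have [wE uE _] := admm_u k.+1.
exact: admm_step (admm_multiplier k admm_u) wE uE.
Qed.

Lemma fixed_point_admm (u : nat -> 'cV[K]_n) : fixed_point_iteration T c u ->
  exists w b, admm mu theta A f L u w b /\
    multiplier_consistent mu theta A f (u 0%N) (b 0%N).
Proof.
move=> fpu.
have th0 : theta%:K != 0 by rewrite fmorph_eq0 gt_eqF.
pose b k := theta%:K^-1 *: (mu%:K *: (adjoint A *m (f - A *m u k))).
have consistent k : multiplier_consistent mu theta A f (u k) (b k).
  by rewrite /multiplier_consistent /b scalerA divff ?scale1r.
have bE k := (multiplier_consistentE _ _).1 (consistent k).
(* The predecessor makes w k.+1 the w-update of u k and b k; at index 0 it only supplies a default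
   value. *)
pose w k := W *m (theta%:K *: u k.-1 + theta%:K *: b k.-1).
have Hu k : shift theta M *m u k.+1 = M *m u k + theta%:K *: w k.+1.
  by rewrite fpu shift_iteration /w /= bE.
exists w, b; split=> // k; split=> //.
  apply: (can_inj (mulKmx shiftM_unit)); rewrite mulKVmx // Hu bE addrC -addrA.
  by rewrite opprB subrK.
apply: (scalerI th0); rewrite scalerBr scalerDr !bE.
have -> : theta%:K *: w k.+1 = M *m u k.+1 + theta%:K *: u k.+1 - M *m u k.
  by rewrite -shiftE Hu addrC addKr.
move: (M *m u k) (M *m u k.+1) => Mu Mu'.
by apply/matrixP => i j; rewrite !mxE; ring.
Qed.

(** Convergence of b follows from theta (b - bs) = - M (u - us), since the energy also bounds |M x|;
    convergence of w then follows from the b-update. *)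
Lemma admm_convergence (u w b : nat -> 'cV[K]_n) : admm mu theta A f L u w b ->
  exists us bs : 'cV[K]_n, [/\ optimal_solution mu A f L us, converges_to u us,
    converges_to w us & converges_to b bs].
Proof.
move=> admm_u; have [us normal_us cvg_us] :=
  fixed_point_energy_cvg (admm_fixed_point admm_u).
have th0 : theta%:K != 0 by rewrite fmorph_eq0 gt_eqF.
pose bs := theta%:K^-1 *: (g - M *m us).
have cvg_u := converges_to_energy cvg_us.
have cvg_b : (dot (b k.+1 - bs) (b k.+1 - bs) @[k --> \oo] --> (0 : R))%classic.
  apply: (@cvg_dot_le _ _ _ (theta ^+ 2) _ _ _ _ cvg_us); first exact: exprn_gt0.
  move=> k /=; rewrite expr2 -mulrA -dotZl -dotZr.
  have -> : theta%:K *: (b k.+1 - bs) = - (M *m (u k.+1 - us)).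
    have /multiplier_consistentE bE := admm_multiplier k admm_u.
    rewrite scalerBr bE /bs scalerA.
    by rewrite divff // scale1r mulmxBr !opprB addrC addrA subrK.
  have := shift_ge theta_gt0 (u k.+1 - us) monotone_gram.
  rewrite /energy dotNl dotNr opprK.
  by have := mulr_ge0 (sqr_ge0 theta) (dot_ge0 (u k.+1 - us)); lra.
exists us, bs; split; first exact: normal_optimal.
- exact/converges_to_shift/converges_to_dot.
(* Two shifts: the b-update expresses w k.+2 through b k.+1, b k.+2 and u k.+2, and the limits above
   concern indices from 1 on. *)
- apply/converges_to_shift/converges_to_shift/converges_to_dot.
  pose bd k := b k.+1 - bs; pose ud k := u k.+1 - us.
  have cvg_bd : (dot (bd k) (bd k) @[k --> \oo] --> (0 : R))%classic by [].
  have cvg_ud : (dot (ud k) (ud k) @[k --> \oo] --> (0 : R))%classic by [].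
  apply: (@cvg_dot_le _ _ _ 1 _ (fun k => 3 *
    (dot (bd k) (bd k) + dot (bd k.+1) (bd k.+1) + dot (ud k.+1) (ud k.+1)))) => //.
    move=> k /=; have -> : w k.+2 - us = bd k + ud k.+1 - bd k.+1.
      have [_ _ bE] := admm_u k.+1; rewrite /bd /ud bE.
      by apply/matrixP => i j; rewrite !mxE; ring.
    move: (bd k) (ud k.+1) (bd k.+1) => x y z.
    (* 3 (|x|^2 + |y|^2 + |z|^2) - |x + y - z|^2 is the sum of these three squares. *)
    have := dot_ge0 (x - y); have := dot_ge0 (x + z); have := dot_ge0 (y + z).
    by rewrite !dotE (dotC y x) (dotC z x) (dotC z y); lra.
  rewrite -(mulr0 3); apply: cvgMr; rewrite -(addr0 0); apply: cvgD.
    rewrite -(addr0 0); apply: cvgD => //.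
    by rewrite (cvg_shiftS (fun k => dot (bd k) (bd k))).
  by rewrite (cvg_shiftS (fun k => dot (ud k) (ud k))).
- exact/converges_to_shift/converges_to_dot.
Qed.

End ADMM.

(** * Eigenvalues and the spectral radius bound *)

(** [eigenvalue] refers to row eigenvectors; a column eigenvector exists because S - a is
    singular. *)
Lemma eigenvalue_col (K : fieldType) n (S : 'M[K]_n) (a : K) : eigenvalue S a ->
  exists2 x : 'cV_n, S *m x = a *: x & x != 0.
Proof.
move=> eig; apply: contrapT => no_eig.
have : S - a%:M \in unitmx.
  apply: unitmx_inj => x /eqP; rewrite mulmxBl mul_scalar_mx subr_eq0 => /eqP Sx.
  by apply/eqP; apply/negP => /negP x0; apply: no_eig; exists x.
rewrite -row_free_unit -kermx_eq0 => /eqP ker0.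
by move: eig; rewrite /eigenvalue /eigenspace ker0 eqxx.
Qed.

Section SpectralRadius.
Context (R : realType).
Local Notation C := (ground_field R Complexes).

(** On an eigenvector T multiplies the positive energy by |a|^2, and the energy does not
    increase. *)
Lemma splitting_eigenvalue n theta (M N : 'M[C]_n) (a : C) :
  0 < theta -> monotone M -> monotone N ->
  eigenvalue (splitting theta M N) a -> modulus a <= 1.
Proof.
move=> theta_gt0 monM monN /eigenvalue_col[x Tx x0].
have := energy_splitting theta_gt0 monM monN x; rewrite Tx.
have -> : energy theta M (a *: x) = modulus a ^+ 2 * energy theta M x.
  by rewrite /energy -scalemxAr dot_scale.
have e_gt0 : 0 < energy theta M x.
  rewrite lt_def energy_ge0 andbT; apply: contra_neq x0.
  exact: energy_eq0.
have := energy_ge0 theta M (x - a *: x) => ge0 le.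
rewrite -(@ler_pXn2r _ 2) ?nnegrE ?modulus_ge0 // expr1n -(ler_pM2r e_gt0) mul1r.
by lra.
Qed.

(** Real data are complexified, so that complex eigenvalues of a real T act on complex vectors of
    the same problem. *)
Lemma iteration_matrix_complex (F : ground) m n mu theta
    (A : 'M[ground_field R F]_(m, n)) (L : 'M[R]_n) :
  map_mx (@to_complex R F) (iteration_matrix mu theta A L)
    = iteration_matrix mu theta (map_mx (@to_complex R F) A : 'M[C]_(m, n)) L.
Proof.
have adjE : map_mx (@to_complex R F) (adjoint A)
    = adjoint (map_mx (@to_complex R F) A : 'M[C]_(m, n)).
  by apply/matrixP => i j; rewrite !mxE to_complex_conj.
have LE : map_mx (@to_complex R F) (map_mx (@of_real R F) L)
    = map_mx (@of_real R Complexes) L.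
  by apply/matrixP => i j; rewrite !mxE to_complex_real.
rewrite /iteration_matrix /Q /u_resolvent /w_resolvent.
rewrite map_mxD map_mx1 map_mxZ map_mxM map_invmx map_mxD map_mxZ map_mxM.
rewrite adjE map_scalar_mx map_mxB map_mxM map_invmx map_mxD map_mxM -map_trmx LE.
by rewrite map_mxB map_mxZ map_mxM adjE !map_scalar_mx rmorph1 /= !to_complex_real.
Qed.

Lemma spectral_radius_le1 (F : ground) m n (A : 'M[ground_field R F]_(m, n))
    (L : 'M[R]_n) mu theta : 0 < mu -> 0 < theta ->
  spectral_radius (iteration_matrix mu theta A L) <= 1.
Proof.
move=> mu_gt0 theta_gt0; rewrite /spectral_radius iteration_matrix_complex.
(* An empty spectrum, as for n = 0, has supremum 0 by default. *)
set E := (X in sup X); have [->|E0] := eqVneq E classical_sets.set0.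
  by rewrite sup0 ler01.
apply: ge_sup; first exact/set0P.
move=> _ [a eig <-].
apply: (@splitting_eigenvalue n theta _ _ a theta_gt0 _ _ eig).
  exact: monotone_gram.
exact: monotone_gram_real.
Qed.

End SpectralRadius.

Theorem theorem1 (R : realType) (F : ground) (m n : nat) (hmn : (m <= n)%N)
    (A : 'M[ground_field R F]_(m, n)) (f : 'cV[ground_field R F]_m) (L : 'M[R]_n)
    (mu : R) (hmu : 0 < mu) (theta : R) (htheta : 0 < theta) :
  let T := iteration_matrix mu theta A L in
  let c := iteration_offset mu theta A f L in
  let ADMM := admm mu theta A f L in
  let optimal := optimal_solution mu A f L in
  [/\ (* equivalence of ADMM and the fixed-point iteration *)
      (forall u w b : nat -> 'cV[ground_field R F]_n, ADMM u w b ->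
         fixed_point_iteration T c (fun k => u k.+1)) /\
      (forall u : nat -> 'cV[ground_field R F]_n,
         fixed_point_iteration T c u <->
         exists w b : nat -> 'cV[ground_field R F]_n,
           ADMM u w b /\ multiplier_consistent mu theta A f (u 0%N) (b 0%N)),
      (* spectral radius *)
      spectral_radius T <= 1,
      (* convergence factor *)
      (forall (u : nat -> 'cV[ground_field R F]_n) (ustar : 'cV[ground_field R F]_n),
         fixed_point_iteration T c u -> optimal ustar ->
         convergence_factor u ustar = (spectral_radius T)%:E ->
         (convergence_factor u ustar <= 1)%E) /\
      (forall (u w b : nat -> 'cV[ground_field R F]_n) (ustar : 'cV[ground_field R F]_n),
         ADMM u w b -> optimal ustar ->
         convergence_factor (fun k => u k.+1) ustar = (spectral_radius T)%:E ->
         (convergence_factor (fun k => u k.+1) ustar <= 1)%E)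
    & (* unconditional convergence *)
      (forall u : nat -> 'cV[ground_field R F]_n, fixed_point_iteration T c u ->
         exists2 ustar, optimal ustar & converges_to u ustar) /\
      (forall u w b : nat -> 'cV[ground_field R F]_n, ADMM u w b ->
         exists ustar bstar : 'cV[ground_field R F]_n,
           [/\ optimal ustar, converges_to u ustar,
               converges_to w ustar & converges_to b bstar])].
Proof.
move=> T c ADMM optimal.
have rho_le1 : spectral_radius T <= 1 by exact: spectral_radius_le1.
split=> //.
- split; first by move=> u w b; apply: admm_fixed_point.
  move=> u; split; first exact: fixed_point_admm.
  case=> w [b [admm_u consistent_0]] k.
  have [wE uE _] := admm_u k; apply: admm_step wE uE => //.
  (* Consistency is assumed at index 0 and automatic at all later ones. *)
  by case: k => // k; apply: admm_multiplier admm_u.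
(* The equality of the factor with the spectral radius reduces both claims to [rho_le1]. *)
- by split=> [u us _ _|u w b us _ _] ->; rewrite lee_fin.
- split; last by move=> u w b; apply: admm_convergence.
  move=> u /(fixed_point_energy_cvg hmu htheta)[us normal_us cvg_us].
  exists us; first exact: normal_optimal.
  by apply: converges_to_dot; apply: converges_to_energy cvg_us.
Qed.
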